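(* Let $r\ge 2$ and $n\geq r+1$ be integers, and let $G$ be a $K_{r+1}$-saturated graph with $n$ vertices. Then $$\sum_{v \in V(G)}d^2(v) \ge (n-1)^2(r-1)+(r-1)^2(n-r+1).$$ Moreover, if $r=2$, equality holds only when $G$ is (isomorphic to) $S_{n,2}$ or a Moore graph with diameter $2$; and if $r\ge 3$, equality holds only when $G$ is (isomorphic to) $S_{n,r}$.
   Context: All graphs are finite and undirected, with no loops or multiple edges. $d(v)$ denotes the degree of $v$ in $G$, and $d^2(v)=(d(v))^2$. For a graph $H$, a graph $G$ is $H$-saturated if $G$ does not contain $H$ as a (not necessarily induced) subgraph but for every edge $e\in E(\overline{G})$ of the complement, $G+e$ contains $H$ as a subgraph. $K_{r+1}$ is the complete graph on $r+1$ vertices. For $2\le r<n$, $S_{n,r}$ is the $n$-vertex graph obtained from a copy of $K_{r-1}$ with vertex set $S$ by adding $n-r+1$ vertices, each of which has neighborhood exactly $S$ (so $S_{n,2}$ is a star). A Moore graph with diameter $2$ is a graph with diameter $2$ and girth $5$. *)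

(* Defs.v *)
From mathcomp Require Import all_boot.

Set Implicit Arguments.
Unset Strict Implicit.
Unset Printing Implicit Defensive.

Record sgraph := SGraph {
  vertex :> finType;
  edge : rel vertex;
  edge_sym : symmetric edge;
  edge_irr : irreflexive edge }.

Definition deg (G : sgraph) (v : G) : nat := #|[set w : G | edge v w]|.

(* Not necessarily induced: non-edges of H may be mapped to edges of G. *)
Definition contains (G H : sgraph) : Prop :=
  exists f : H -> G, injective f /\ (forall x y, edge x y -> edge (f x) (f y)).

Definition isomorphic (G H : sgraph) : Prop :=
  exists f : G -> H, bijective f /\ (forall x y, edge (f x) (f y) = edge x y).

(* The conjunct x != y makes this total: if u = v, no edge is added. *)
Definition add_rel (G : sgraph) (u v : G) : rel G := fun x y =>
  edge x y || (x != y) && ((x == u) && (y == v) || (x == v) && (y == u)).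

Lemma add_rel_sym (G : sgraph) (u v : G) : symmetric (add_rel u v).
Proof.
move=> x y; rewrite /add_rel edge_sym eq_sym; congr (_ || (_ && _)).
by rewrite orbC; congr (_ || _); rewrite andbC.
Qed.

Lemma add_rel_irr (G : sgraph) (u v : G) : irreflexive (add_rel u v).
Proof. by move=> x; rewrite /add_rel edge_irr eqxx. Qed.

Definition add_edge (G : sgraph) (u v : G) : sgraph :=
  SGraph (@add_rel_sym G u v) (@add_rel_irr G u v).

Definition saturated (H G : sgraph) : Prop :=
  ~ contains G H /\
  (forall u v : G, u != v -> ~~ edge u v -> contains (add_edge u v) H).

Definition complete_rel (k : nat) : rel 'I_k := fun x y => x != y.

Lemma complete_rel_sym k : symmetric (@complete_rel k).
Proof. by move=> x y; rewrite /complete_rel eq_sym. Qed.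

Lemma complete_rel_irr k : irreflexive (@complete_rel k).
Proof. by move=> x; rewrite /complete_rel eqxx. Qed.

Definition complete (k : nat) : sgraph :=
  SGraph (@complete_rel_sym k) (@complete_rel_irr k).

(* S_{n,r} for 2 <= r < n, with S = {0, ..., r-2}: two distinct vertices are
   adjacent iff at least one of them lies in S. *)
Definition split_rel (n r : nat) : rel 'I_n := fun x y =>
  (x != y) && ((x < r - 1) || (y < r - 1)).

Lemma split_rel_sym n r : symmetric (@split_rel n r).
Proof. by move=> x y; rewrite /split_rel eq_sym orbC. Qed.

Lemma split_rel_irr n r : irreflexive (@split_rel n r).
Proof. by move=> x; rewrite /split_rel eqxx. Qed.

Definition split_graph (n r : nat) : sgraph :=
  SGraph (@split_rel_sym n r) (@split_rel_irr n r).

Definition walk (G : sgraph) (x y : G) (k : nat) : Prop :=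
  exists p : seq G, [/\ path (@edge G) x p, last x p = y & size p = k].

Definition distance (G : sgraph) (x y : G) (k : nat) : Prop :=
  walk x y k /\ (forall j, walk x y j -> k <= j).

(* As a relation, so that a disconnected graph has no (finite) diameter. *)
Definition diameter (G : sgraph) (d : nat) : Prop :=
  (forall x y : G, exists2 k, distance x y k & k <= d) /\
  (exists x y : G, distance x y d).

(* ucycle alone also accepts sequences of length 0 and 2. *)
Definition graph_cycle (G : sgraph) (c : seq G) : Prop :=
  3 <= size c /\ ucycle (@edge G) c.

Definition girth (G : sgraph) (g : nat) : Prop :=
  (exists2 c : seq G, graph_cycle c & size c = g) /\
  (forall c : seq G, graph_cycle c -> g <= size c).

Definition moore_diameter2 (G : sgraph) : Prop := diameter G 2 /\ girth G 5.

(* Main.v *)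
(* Only one consequence of saturation is needed: with s = r - 1, two nonadjacent
   vertices have a common s-clique. Identifying nonadjacent vertices preserves this
   and destroys at least s edges, which gives 2 e(G) >= 2 s n - s (s + 1)
   (Erdos-Hajnal-Moon), with equality only for S_{n,r}.

   The sum of the squared degrees is 2 e(G) plus the sum of the codegrees over all
   ordered pairs, and the sum over adjacent pairs counts the edges inside the
   neighbourhoods N(v). Add to the graph induced on N(v) the nonedges xy which have
   no common s-clique through v; then nonadjacent vertices have a common
   (s - 1)-clique, so the edge bound applies to it. A nonedge xy is added in at most
   codeg(x, y) - s neighbourhoods, which is exactly the excess that nonadjacent pairs
   contribute, so that the sum of the squared degrees is at least
   s n (n - 1) + (s - 1) (2 e(G) - s n), and the edge bound for G finishes.

   If r = 2, equality means that nonadjacent vertices have exactly one common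
   neighbour and adjacent ones none. *)

Require Import Defs.
From mathcomp Require Import all_boot zify.

Set Implicit Arguments.
Unset Strict Implicit.
Unset Printing Implicit Defensive.

(** * Cliques joining nonadjacent vertices, and identification of two vertices *)

Section CommonCliques.

Variable T : finType.
Implicit Types (e : rel T) (A Q S : {set T}) (v x y z : T) (k : nat).

Definition common_clique e A k x y Q :=
  [&& Q \subset A, #|Q| == k,
      [forall a in Q, forall b in Q, (a != b) ==> e a b]
    & [forall a in Q, e x a && e y a]].

Definition clique_joined e A k := forall x y,
  x \in A -> y \in A -> x != y -> ~~ e x y -> exists Q, common_clique e A k x y Q.

(* Ordered pairs: every edge inside A is counted twice. *)
Definition arcs e A := \sum_(x in A) \sum_(y in A) e x y.

Definition codeg e A x y := \sum_(z in A) (e x z && e y z).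

(** On the full vertex set this is the structure of S_{n,k+1}, with [S] as its central clique. *)
Definition dominating_core e A k S := [/\ S \subset A, #|S| = k,
  {in S & A, forall x y, x != y -> e x y} & {in A :\: S &, forall x y, ~~ e x y}].

Lemma common_cliqueP e A k x y Q :
  reflect [/\ Q \subset A, #|Q| = k, {in Q &, forall a b, a != b -> e a b}
             & {in Q, forall a, e x a /\ e y a}]
          (common_clique e A k x y Q).
Proof.
apply: (iffP and4P) => [[sQA /eqP cQ /forall_inP clQ /forall_inP adjQ]|].
  split=> // [a b aQ bQ|a aQ]; last exact/andP/adjQ.
  by move/forall_inP/(_ b bQ)/implyP: (clQ a aQ); apply.
move=> [sQA cQ clQ adjQ]; split=> //; first exact/eqP.
  by apply/forall_inP=> a aQ; apply/forall_inP=> b bQ; apply/implyP/clQ.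
by apply/forall_inP=> a aQ; apply/andP/adjQ.
Qed.

Lemma common_clique_codeg e A k x y Q :
  common_clique e A k x y Q -> k <= codeg e A x y.
Proof.
case/common_cliqueP=> sQA <- _ adjQ.
rewrite -sum1_card /codeg [leqRHS](big_setID Q) /= (setIidPr sQA).
apply: leq_trans (leq_addr _ _); apply: leq_sum => a aQ.
by have [-> ->] := adjQ a aQ.
Qed.

(** The merged vertex keeps the name x; y disappears by restriction to [A :\ y]. *)
Definition identify e x y : rel T := fun a b =>
  [|| e a b, (a == x) && e y b | (b == x) && e a y].

Section Identify.

Variables (e : rel T) (A : {set T}) (x y : T).
Hypotheses (e_sym : symmetric e) (e_irr : irreflexive e).
Hypotheses (xA : x \in A) (yA : y \in A) (nxy : x != y) (nexy : ~~ e x y).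

Lemma identify_sym : symmetric (identify e x y).
Proof.
move=> a b; rewrite /identify (e_sym b a) (e_sym b y) (e_sym a y).
by rewrite [_ && e y b || _]orbC.
Qed.

Lemma identify_irr : irreflexive (identify e x y).
Proof.
move=> a; rewrite /identify e_irr; case: eqP => //= ->.
by rewrite (e_sym y) orbb (negPf nexy).
Qed.

(** The map sending y to x preserves edges and is injective on a clique, which cannot contain both
    of the nonadjacent vertices x and y. *)
Lemma clique_joined_identify k :
  clique_joined e A k -> clique_joined (identify e x y) (A :\ y) k.
Proof.
move=> joinA p q; rewrite !inE => /andP[npy pA] /andP[nqy qA] npq.
rewrite {1}/identify !negb_or => /and3P[nepq _ _].
have [Q /common_cliqueP[sQA cQ clQ adjQ]] := joinA p q pA qA npq nepq.
pose f a := if a == y then x else a.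
have f_edge a b : e a b -> identify e x y (f a) (f b).
  rewrite /f /identify; case: (eqVneq a y) => [->|_]; case: (eqVneq b y) => [->|_].
  - by rewrite e_irr.
  - by move=> ->; rewrite eqxx orbT.
  - by move=> ->; rewrite eqxx !orbT.
  - by move=> ->.
have f_inj : {in Q &, injective f}.
  move=> a b aQ bQ; rewrite /f.
  case: (eqVneq a y) => [ay|nay]; case: (eqVneq b y) => [bY|nby] //; rewrite ?ay ?bY //.
    by move=> xb; case/negP: nexy; rewrite xb -ay e_sym clQ // ay eq_sym.
  by move=> ax; case/negP: nexy; rewrite -ax -bY clQ // bY.
exists (f @: Q); apply/common_cliqueP; split.
- apply/subsetP=> _ /imsetP[a aQ ->]; rewrite !inE /f.
  by case: (eqVneq a y) => [_|nay]; rewrite ?nxy ?nay // (subsetP sQA).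
- by rewrite card_in_imset.
- move=> _ _ /imsetP[a aQ ->] /imsetP[b bQ ->] nfab.
  by apply/f_edge/clQ => //; apply: contraNneq nfab => ->.
move=> _ /imsetP[a aQ ->]; have [epa eqa] := adjQ a aQ.
by move: (f_edge _ _ epa) (f_edge _ _ eqa); rewrite /f (negPf npy) (negPf nqy).
Qed.

Lemma sum_split2 (F : T -> nat) :
  \sum_(a in A) F a = F x + F y + \sum_(a in A :\ x :\ y) F a.
Proof.
have yAx : y \in A :\ x by rewrite !inE eq_sym nxy.
by rewrite (big_setD1 x xA) (big_setD1 y yAx) /= addnA.
Qed.

(** For each common neighbour z of x and y the edges xz and yz become one, and each lost edge counts
    twice. *)
Lemma arcs_identify :
  arcs e A = arcs (identify e x y) (A :\ y) + 2 * codeg e A x y.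
Proof.
have xAy : x \in A :\ y by rewrite !inE nxy.
have setE : A :\ y :\ x = A :\ x :\ y by apply/setP=> a; rewrite !inE andbCA.
have restE a b : a \in A :\ x :\ y -> b \in A :\ x :\ y ->
    identify e x y a b = e a b.
  by rewrite !inE /identify => /and3P[_ /negPf-> _] /and3P[_ /negPf-> _] /=; rewrite orbF.
have xE b : b \in A :\ x :\ y -> identify e x y x b = e x b || e y b.
  by rewrite !inE /identify eqxx => /and3P[_ /negPf-> _] /=; rewrite orbF.
rewrite /arcs /codeg !sum_split2 (big_setD1 x xAy) setE /=.
rewrite (big_setD1 x xAy) setE /= identify_irr.
rewrite !e_irr (e_sym y x) (negPf nexy) /= !add0n.
under [X in _ + X = _]eq_bigr => a _ do rewrite sum_split2.
rewrite !big_split /=.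
under [in RHS]eq_bigr => b bA do rewrite xE //.
under [X in _ = _ + X + _]eq_bigr => a aA.
  rewrite (big_setD1 x xAy) setE /= identify_sym xE //.
  under eq_bigr => b bA do rewrite restE //.
  over.
rewrite !big_split /=.
under [X in _ + (X + _ + _)]eq_bigr do rewrite e_sym.
under [X in _ + (_ + X + _)]eq_bigr do rewrite e_sym.
set s := \sum_(_ in _) \sum_(_ in _) _.
(* Inclusion-exclusion for the neighbourhoods of x and y. *)
have : \sum_(b in A :\ x :\ y) (e x b || e y b) + \sum_(b in A :\ x :\ y) (e x b && e y b) =
   \sum_(b in A :\ x :\ y) e x b + \sum_(b in A :\ x :\ y) e y b.
  by rewrite -!big_split /=; apply: eq_bigr => b _; case: (e x b); case: (e y b).
by lia.
Qed.

End Identify.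

(** * Lower bound on the number of edges *)

Lemma codegE e A x y : codeg e A x y = #|[set z in A | e x z && e y z]|.
Proof.
rewrite /codeg -sum1_card [RHS](eq_bigl (fun z => (z \in A) && (e x z && e y z))).
  by rewrite big_mkcondr; apply: eq_bigr => z _; case: (_ && _).
by move=> z; rewrite inE.
Qed.

Lemma codegC e A x y : codeg e A x y = codeg e A y x.
Proof. by apply: eq_bigr => z _; rewrite andbC. Qed.

Lemma complete_or_nonedge e A :
  {in A &, forall x y, x != y -> e x y} \/
  exists x y, [/\ x \in A, y \in A, x != y & ~~ e x y].
Proof.
have [/exists_inP[x xA /exists_inP[y yA /andP[]]]|noxy] :=
  boolP [exists x in A, exists y in A, (x != y) && ~~ e x y].
  by right; exists x, y.
left=> x y xA yA nxy; apply: contraNT noxy => nexy.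
by apply/exists_inP; exists x => //; apply/exists_inP; exists y; rewrite ?nxy.
Qed.

Lemma arcs_complete e A : irreflexive e ->
  {in A &, forall x y, x != y -> e x y} -> arcs e A = #|A| * #|A|.-1.
Proof.
move=> e_irr complA; rewrite /arcs -sum_nat_const; apply: eq_bigr => x xA.
rewrite (big_setD1 x xA) /= e_irr (cardsD1 x A) xA /= -sum1_card.
apply: eq_bigr => y; rewrite !inE => /andP[nyx yA].
by rewrite complA // eq_sym.
Qed.

Lemma complete_arcs_bound a k : 2 * k * a <= a * a.-1 + k * k.+1.
Proof.
have [/subnKC<-|/subnKC<-] := leqP a k.
  by case: a => [|a] /=; move: (k - _) => t; nia.
by move: (a - _) => t; rewrite addSn /=; nia.
Qed.

(** The difference of the two sides is (a - k)(a - k - 1), which vanishes only for a = k and a = k +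
    1. *)
Lemma complete_arcs_eq a k : a * a.-1 + k * k.+1 = 2 * k * a -> a <= k.+1.
Proof.
have [//|/subnKC<-] := leqP a k.+1.
by move: (a - _) => t; rewrite addSn /=; nia.
Qed.

(* Identifying two nonadjacent vertices destroys at least k edges and preserves
   [clique_joined]; a complete graph on m vertices satisfies the bound because
   (m - k)(m - k - 1) >= 0. *)
Lemma arcs_lower_bound e A k : symmetric e -> irreflexive e ->
  clique_joined e A k -> 2 * k * #|A| <= arcs e A + k * k.+1.
Proof.
have [m cA] := ubnP #|A|; elim: m => // m IHm in e A cA *.
move=> e_sym e_irr joinA.
have [complA|[x [y [xA yA nxy nexy]]]] := complete_or_nonedge e A.
  by rewrite arcs_complete // complete_arcs_bound.
have [Q QP] := joinA x y xA yA nxy nexy.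
have ck := common_clique_codeg QP.
rewrite (arcs_identify e_sym e_irr xA yA nxy nexy).
have cAy := cardsD1 y A; rewrite yA in cAy.
have := IHm _ (A :\ y) _ (identify_sym _ _ e_sym) (identify_irr e_sym e_irr nexy)
  (clique_joined_identify e_sym e_irr xA nxy nexy joinA).
by move/(_ ltac:(lia)); rewrite cAy mulnDr; lia.
Qed.

(** * Equality in the edge bound *)

Lemma arcs_eq_codeg e A k x y : symmetric e -> irreflexive e ->
  clique_joined e A k -> arcs e A + k * k.+1 = 2 * k * #|A| ->
  x \in A -> y \in A -> x != y -> ~~ e x y ->
  codeg e A x y = k /\
  arcs (identify e x y) (A :\ y) + k * k.+1 = 2 * k * #|A :\ y|.
Proof.
move=> e_sym e_irr joinA eqA xA yA nxy nexy.
have [Q QP] := joinA x y xA yA nxy nexy.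
have ck := common_clique_codeg QP.
have cAy := cardsD1 y A; rewrite yA in cAy.
(* Removing y lowers the bound by 2k, while the merge loses 2 codeg >= 2k arcs; equality forces both
   to be tight. *)
have := arcs_lower_bound (identify_sym _ _ e_sym) (identify_irr e_sym e_irr nexy)
  (clique_joined_identify e_sym e_irr xA nxy nexy joinA).
by move: eqA; rewrite (arcs_identify e_sym e_irr xA yA nxy nexy) cAy mulnDr; lia.
Qed.

Section CoreLift.

Variables (e : rel T) (A S : {set T}) (x y : T) (k : nat).
Hypotheses (e_sym : symmetric e) (e_irr : irreflexive e).
Hypotheses (xA : x \in A) (yA : y \in A) (nxy : x != y) (nexy : ~~ e x y).
Hypothesis codeg_eq : forall p q,
  p \in A -> q \in A -> p != q -> ~~ e p q -> codeg e A p q = k.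
Hypothesis coreS : dominating_core (identify e x y) (A :\ y) k S.

(** Vertices outside S are independent in the merged graph, so all neighbours of x and y lie in S.
    As x and y have k = |S| common neighbours, S is exactly their common neighbourhood. *)
Lemma dominating_core_lift_notin : x \notin S -> dominating_core e A k S.
Proof.
move=> xS; have [sSA cS domS indS] := coreS.
have xAS : x \in A :\ y :\: S by rewrite !inE xS nxy.
have nbrS z : z \in A -> e x z || e y z -> z \in S.
  move=> zA; apply: contraTT => zS.
  have nzy : z != y \/ z = y by case: (eqVneq z y); [right | left].
  case: nzy => [nzy|->]; last by rewrite e_irr (negPf nexy).
  have zAS : z \in A :\ y :\: S by rewrite !inE zS nzy.
  have := indS x z xAS zAS; rewrite /identify eqxx !negb_or /=.
  by case/and3P=> -> ->.
have commS : S = [set z in A | e x z && e y z].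
  apply/esym/eqP; rewrite eqEcard cS -codegE codeg_eq // leqnn andbT.
  by apply/subsetP=> z; rewrite inE => /andP[zA /andP[exz _]]; rewrite nbrS ?exz.
have yS : y \notin S by apply/negP=> /(subsetP sSA); rewrite !inE eqxx.
have restE a b : a != x -> b != x -> identify e x y a b = e a b.
  by rewrite /identify => /negPf-> /negPf->; rewrite orbF.
split=> //.
- by apply: subset_trans sSA (subD1set _ _).
- move=> s a sS aA nsa.
  have [exs eys] : e x s /\ e y s by move: sS; rewrite commS inE => /and3P[].
  case: (eqVneq a x) => [->|nax]; first by rewrite e_sym.
  case: (eqVneq a y) => [->|nay]; first by rewrite e_sym.
  rewrite -restE //; last by apply: contraNneq xS => <-.
  by apply: domS => //; rewrite !inE nay.
move=> a b; rewrite !inE => /andP[aS aA] /andP[bS bA].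
case: (eqVneq a y) => [->|nay]; first by apply: contra bS => eyb; rewrite nbrS ?eyb ?orbT.
case: (eqVneq b y) => [->|nby].
  by apply: contra aS => eay; rewrite nbrS // (e_sym y) eay orbT.
have := indS a b; rewrite !inE aS aA nay bS bA nby /identify !negb_or.
by move=> /(_ isT isT) /and3P[].
Qed.

(** The clique Q turns out to be S without x plus one vertex w0, and A consists of Q, x and y
    only. *)
Lemma dominating_core_lift_in Q :
  common_clique e A k x y Q -> x \in S -> dominating_core e A k Q.
Proof.
move=> /common_cliqueP[sQA cQ clQ adjQ] xS; have [sSA cS domS indS] := coreS.
have xQ : x \notin Q by apply/negP=> /adjQ[]; rewrite e_irr.
have yQ : y \notin Q by apply/negP=> /adjQ[]; rewrite e_irr.
have indW a b : a \in A -> b \in A -> a != y -> b != y -> a \notin S -> b \notin S ->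
    ~~ e a b.
  move=> aA bA nay nby aS bS.
  have := indS a b; rewrite !inE aS aA nay bS bA nby /identify !negb_or.
  by move=> /(_ isT isT) /and3P[].
have cR : #|S :\ x|.+1 = k by rewrite -cS (cardsD1 x S) xS.
have /subsetPn[w0 w0Q w0R] : ~~ (Q \subset S :\ x).
  by apply/negP=> /subset_leq_card; rewrite cQ -cR ltnn.
have w0x : w0 != x by apply: contraNneq xQ => <-.
have w0y : w0 != y by apply: contraNneq yQ => <-.
have w0S : w0 \notin S by move: w0R; rewrite !inE w0x.
have w0A := subsetP sQA w0 w0Q.
(* Vertices outside S other than y are pairwise nonadjacent, so w0 is the only vertex of the clique
   Q outside S. *)
have RQ : S :\ x = Q :\ w0.
  apply/esym/eqP; rewrite eqEcard; apply/andP; split.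
    apply/subsetP=> a; rewrite !inE => /andP[naw aQ].
    have nax : a != x by apply: contraNneq xQ => <-.
    have nay : a != y by apply: contraNneq yQ => <-.
    rewrite nax /=; apply/negPn/negP=> aS.
    by move: (indW a w0 (subsetP sQA a aQ) w0A nay w0y aS w0S); rewrite clQ.
  by rewrite -ltnS cR -cQ (cardsD1 w0 Q) w0Q.
(* If [e p w] with {p, q} = {x, y}, then w is not adjacent to q, and all common
   neighbours of q and w lie in the (k - 1)-set [S :\ x]. *)
have outW p q w : w \in A -> w \notin S -> w != w0 -> w != y -> w != x ->
    (p == x) && (q == y) || (p == y) && (q == x) -> e p w -> False.
  move=> wA wS nww0 nwy nwx pq epw.
  have [qA nqp nw_q] : [/\ q \in A, ~~ e q p & w != q].
    by case/orP: pq => /andP[/eqP-> /eqP->]; split=> //; rewrite e_sym.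
  have npq : codeg e A p q = k.
    by case/orP: pq => /andP[/eqP-> /eqP->]; rewrite ?(codegC _ _ y); apply: codeg_eq.
  have adjpq a : a \in Q -> e p a && e q a.
    by move=> /adjQ[exa eya]; case/orP: pq => /andP[/eqP-> /eqP->]; rewrite exa eya.
  have wQ : w \notin Q.
    apply/negP=> wQ; have : w \in Q :\ w0 by rewrite !inE nww0.
    by rewrite -RQ !inE (negPf wS) andbF.
  (* If qw were an edge, w and Q would give p and q at least k + 1 common neighbours. *)
  have nqw : ~~ e q w.
    apply/negP=> eqw; have : w |: Q \subset [set z in A | e p z && e q z].
      apply/subsetP=> a; rewrite !inE => /orP[/eqP->|aQ]; first by rewrite wA epw.
      by rewrite (subsetP sQA) ?adjpq.
    by move/subset_leq_card; rewrite -codegE npq cardsU1 wQ cQ ltnn.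
  have cqw : codeg e A q w = k by apply: codeg_eq; rewrite // eq_sym.
  suff /subset_leq_card : [set z in A | e q z && e w z] \subset S :\ x.
    by rewrite -codegE cqw -cR ltnn.
  apply/subsetP=> z; rewrite inE => /and3P[zA eqz ewz].
  have [nzx nzy] : z != x /\ z != y.
    have: z != p by apply: contraNneq nqp => <-.
    have: z != q by apply: contraTneq eqz => ->; rewrite e_irr.
    by case/orP: pq => /andP[/eqP-> /eqP->].
  rewrite !inE nzx; apply: contraTT ewz => zS; exact: indW.
have AQ a : a \in A -> a != x -> a != y -> a \in Q.
  move=> aA nax nay; have [aS|aS] := boolP (a \in S).
    have : a \in S :\ x by rewrite !inE nax.
    by rewrite RQ => /setD1P[].
  have [->//|naw0] := eqVneq a w0.
  (* In the merged graph x is adjacent to a, so a is adjacent to x or y in the original; [outW]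
     excludes both. *)
  have : identify e x y x a by apply: domS; rewrite ?inE ?nay // eq_sym.
  rewrite /identify eqxx (negPf nax) /= orbF => /orP[exa|eya].
    by case: (outW x y a); rewrite ?eqxx.
  by case: (outW y x a); rewrite ?eqxx ?orbT.
split=> // [s a sQ aA nsa|a b].
  have [exs eys] := adjQ s sQ.
  case: (eqVneq a x) => [->|nax]; first by rewrite e_sym.
  case: (eqVneq a y) => [->|nay]; first by rewrite e_sym.
  by apply: clQ => //; apply: AQ.
have outQ c : c \in A :\: Q -> c = x \/ c = y.
  rewrite inE => /andP[cQ' cA].
  have [->|ncx] := eqVneq c x; first by left.
  have [->|ncy] := eqVneq c y; first by right.
  by rewrite AQ in cQ'.
by move=> /outQ[->|->] /outQ[->|->]; rewrite ?e_irr // e_sym.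
Qed.

End CoreLift.

(** Equality passes to the merged graph, whose core is lifted back; the two lifts differ in whether
    the core contains the merged vertex. *)
Lemma arcs_eq_core e A k : symmetric e -> irreflexive e ->
  clique_joined e A k -> k <= #|A| -> arcs e A + k * k.+1 = 2 * k * #|A| ->
  exists S, dominating_core e A k S.
Proof.
have [m cA] := ubnP #|A|; elim: m => // m IHm in e A cA *.
move=> e_sym e_irr joinA leA eqA.
have [complA|[x [y [xA yA nxy nexy]]]] := complete_or_nonedge e A.
  (* A complete graph with equality has at most k + 1 vertices, so any k of them leave at most one
     outside. *)
  have [S] : exists S, S \subset A /\ #|S| = k.
    have sk : size (take k (enum A)) = k by rewrite size_takel // -cardE.
    exists [set z in take k (enum A)]; split.
      by apply/subsetP=> z; rewrite inE => /mem_take; rewrite mem_enum.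
    by rewrite -[RHS]sk cardsE; apply/card_uniqP/take_uniq/enum_uniq.
  case=> sSA cS; exists S; split=> // [x y xS yA|x y xAS yAS].
    exact: complA (subsetP sSA x xS) yA.
  have : #|A| <= k.+1 by apply: complete_arcs_eq; rewrite -eqA arcs_complete.
  have -> : #|A| = k + #|A :\: S| by rewrite -cS -(cardsID S A) (setIidPr sSA).
  rewrite -addn1 leq_add2l => /card_le1_eqP/(_ _ _ xAS yAS) ->.
  by rewrite e_irr.
have [Q QP] := joinA x y xA yA nxy nexy.
have codeg_eq p q : p \in A -> q \in A -> p != q -> ~~ e p q -> codeg e A p q = k.
  by move=> pA qA npq nepq; case: (arcs_eq_codeg e_sym e_irr joinA eqA pA qA npq nepq).
have [_ eqA'] := arcs_eq_codeg e_sym e_irr joinA eqA xA yA nxy nexy.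
have cAy := cardsD1 y A; rewrite yA in cAy.
have leA' : k <= #|A :\ y|.
  have /common_cliqueP[sQA <- _ adjQ] := QP; apply/subset_leq_card/subsetP=> z zQ.
  rewrite !inE (subsetP sQA) // andbT; apply: contraTneq zQ => ->.
  by apply/negP=> /adjQ[]; rewrite e_irr.
have [S coreS] := IHm _ (A :\ y) ltac:(lia) (identify_sym _ _ e_sym)
  (identify_irr e_sym e_irr nexy)
  (clique_joined_identify e_sym e_irr xA nxy nexy joinA) leA' eqA'.
have [xS|xS] := boolP (x \in S).
  by exists Q; apply: (dominating_core_lift_in e_sym e_irr xA yA nxy nexy codeg_eq coreS).
by exists S; apply: (dominating_core_lift_notin e_sym e_irr xA yA nxy nexy codeg_eq coreS).
Qed.

(** * Links and the sum of squared degrees *)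

Definition nbr e v := [set w | e v w].

Lemma common_cliqueC e A k x y Q :
  common_clique e A k x y Q = common_clique e A k y x Q.
Proof.
by rewrite /common_clique; do 3 congr (_ && _); apply: eq_forallb_in => a _; rewrite andbC.
Qed.

Definition joined_through e k v x y :=
  [exists Q : {set T}, (v \in Q) && common_clique e setT k x y Q].

(* The neighbourhood of v, completed by the nonedges xy of G for which no common
   k-clique passes through v; deleting v from the others shows that any two
   nonadjacent vertices have a common (k - 1)-clique. *)
Definition link e k v : rel T := fun x y =>
  (x != y) && (e x y || ~~ joined_through e k v x y).

Section DegreeSquares.

Variables (e : rel T) (k : nat).
Hypotheses (e_sym : symmetric e) (e_irr : irreflexive e).

Lemma link_sym v : symmetric (link e k v).
Proof.
move=> x y; rewrite /link eq_sym e_sym; congr (_ && (_ || ~~ _)).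
by apply: eq_existsb => Q; rewrite common_cliqueC.
Qed.

Lemma link_irr v : irreflexive (link e k v).
Proof. by move=> x; rewrite /link eqxx. Qed.

Lemma clique_joined_link v : clique_joined (link e k v) (nbr e v) k.-1.
Proof.
have neq a b : e a b -> a != b by apply: contraTneq => ->; rewrite e_irr.
move=> x y xv yv nxy; rewrite /link nxy negb_or negbK.
case/andP=> _ /existsP[Q /andP[vQ /common_cliqueP[_ cQ clQ adjQ]]].
exists (Q :\ v); apply/common_cliqueP; split.
- apply/subsetP=> a; rewrite !inE => /andP[nav aQ].
  by apply: clQ; rewrite // eq_sym.
- by rewrite -cQ (cardsD1 v Q) vQ.
- by move=> a b /setD1P[_ aQ] /setD1P[_ bQ] nab; rewrite nab clQ.
by move=> a /setD1P[_ /adjQ[exa eya]]; rewrite !neq ?exa ?eya.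
Qed.

Lemma sum_setT (F : T -> nat) : \sum_(x in [set: T]) F x = \sum_x F x.
Proof. by apply: eq_bigl => x; rewrite inE. Qed.

Lemma codegTE x y : codeg e setT x y = \sum_z (e x z && e y z).
Proof. exact: sum_setT. Qed.

Lemma card_nbr v : #|nbr e v| = \sum_w e v w.
Proof.
rewrite -sum1_card big_mkcond; apply: eq_bigr => w _.
by rewrite inE; case: (e v w).
Qed.

Lemma arcsT : arcs e setT = \sum_v #|nbr e v|.
Proof.
rewrite /arcs sum_setT; apply: eq_bigr => v _.
by rewrite card_nbr sum_setT.
Qed.

(** Both sides count walks of length two, on the left by the middle vertex and on the right by the
    ends; the closed ones give the degree sum. *)
Lemma sum_sqr_nbr :
  \sum_v #|nbr e v| ^ 2 = \sum_v #|nbr e v| + \sum_x \sum_y (x != y) * codeg e setT x y.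
Proof.
transitivity (\sum_x \sum_y codeg e setT x y).
  under eq_bigr do rewrite -mulnn card_nbr big_distrl /=.
  rewrite exchange_big; apply: eq_bigr => x _ /=.
  under eq_bigr do rewrite big_distrr /=.
  rewrite exchange_big; apply: eq_bigr => y _ /=.
  by rewrite codegTE; apply: eq_bigr => z _; rewrite mulnb e_sym (e_sym z y).
rewrite -big_split; apply: eq_bigr => x _ /=.
rewrite (bigD1 x) //= [in RHS](bigD1 x) //= eqxx mul0n add0n codegTE card_nbr.
congr (_ + _); first by apply: eq_bigr => z _; rewrite andbb.
by apply: eq_bigr => y; rewrite eq_sym => ->; rewrite mul1n.
Qed.

Lemma sum_nonedges :
  \sum_x \sum_y ((x != y) && ~~ e x y) + \sum_v #|nbr e v| + #|T| = #|T| ^ 2.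
Proof.
have cT : #|T| = \sum_(x : T) 1 by rewrite -sum1_card.
rewrite -mulnn [X in _ = X * _]cT [X in _ + X = _]cT -!big_split big_distrl /=.
apply: eq_bigr => x _; rewrite mul1n card_nbr cT (bigD1 x) //=.
rewrite [X in _ + X + 1](bigD1 x) //= [RHS](bigD1 x) //= eqxx e_irr !add0n.
rewrite addnC -big_split; congr (_ + _); apply: eq_bigr => y /=.
by rewrite eq_sym => ->; case: (e x y).
Qed.

Hypothesis joinT : clique_joined e setT k.

(* A common neighbour v of nonadjacent x, y contributes to the left-hand side only
   if xy is an added edge of its link, hence not if v lies in their common clique. *)
Lemma sum_link_codeg x y :
  \sum_v [&& e v x, e v y & link e k v x y] + k * ((x != y) && ~~ e x y)
    <= (x != y) * codeg e setT x y.
Proof.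
rewrite codegTE; have [->|nxy] := eqVneq x y.
  by rewrite mul0n muln0 addn0 leqn0 sum_nat_eq0; apply/forallP=> v; rewrite link_irr !andbF.
rewrite mul1n /=; have [exy|nexy] /= := boolP (e x y).
  rewrite muln0 addn0; apply: leq_sum => v _.
  by rewrite e_sym (e_sym v y); case: (e x v); case: (e y v); case: link.
have [Q QP] := joinT (in_setT x) (in_setT y) nxy nexy.
have /common_cliqueP[_ cQ _ adjQ] := QP.
rewrite muln1 -[X in _ + X <= _]cQ -sum1_card [X in _ + X]big_mkcond -big_split /=.
apply: leq_sum => v _; rewrite e_sym (e_sym v y).
case: ifP => [vQ|_]; last by case: (e x v); case: (e y v); case: link.
have [-> ->] := adjQ v vQ; rewrite /link nxy (negPf nexy) /=.
suff -> : joined_through e k v x y by [].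
by apply/existsP; exists Q; rewrite vQ.
Qed.

Lemma sum_sqr_nbr_lower_bound : 0 < k ->
  k * #|T| ^ 2 + k.-1 * \sum_v #|nbr e v| <= \sum_v #|nbr e v| ^ 2 + k ^ 2 * #|T|.
Proof.
move=> k_gt0.
have linkE : \sum_v arcs (link e k v) (nbr e v) =
    \sum_x \sum_y \sum_v [&& e v x, e v y & link e k v x y].
  under [RHS]eq_bigr do rewrite exchange_big /=.
  rewrite exchange_big; apply: eq_bigr => v _ /=.
  rewrite /arcs big_mkcond; apply: eq_bigr => x _; rewrite inE.
  case: (e v x) => /=; last by rewrite big1.
  by rewrite big_mkcond; apply: eq_bigr => y _; rewrite inE; case: (e v y).
have le1 : \sum_v arcs (link e k v) (nbr e v) +
    k * \sum_x \sum_y ((x != y) && ~~ e x y) <= \sum_x \sum_y (x != y) * codeg e setT x y.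
  rewrite linkE big_distrr -big_split; apply: leq_sum => x _ /=.
  rewrite big_distrr -big_split; apply: leq_sum => y _ /=; exact: sum_link_codeg.
(* The edge bound for each link, with k - 1 in place of k. *)
have le2 : 2 * k.-1 * \sum_v #|nbr e v| <=
    \sum_v arcs (link e k v) (nbr e v) + #|T| * (k.-1 * k).
  have -> : #|T| * (k.-1 * k) = \sum_(v : T) k.-1 * k by rewrite sum_nat_const.
  rewrite big_distrr -big_split /=.
  apply: leq_sum => v _.
  have := arcs_lower_bound (link_sym v) (link_irr v) (@clique_joined_link v).
  by rewrite prednK.
(* Here a counts the arcs of all links, b the ordered nonadjacent pairs, c sums the codegrees of
   distinct pairs, m is the degree sum and n the order. *)
have arith a b c m n : a + k * b <= c -> 2 * k.-1 * m <= a + n * (k.-1 * k) ->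
    b + m + n = n ^ 2 -> k * n ^ 2 + k.-1 * m <= m + c + k ^ 2 * n.
  case: (k) k_gt0 => // k' _ /= le_c le_m <-.
  have -> : k'.+1 * (b + m + n) = k'.+1 * b + k'.+1 * m + k'.+1 * n by rewrite !mulnDr.
  by rewrite -mulnn; lia.
rewrite sum_sqr_nbr; exact: arith le1 le2 sum_nonedges.
Qed.

(** For k = 1 the codegree of a pair of distinct vertices is at least its nonedge indicator;
    equality of the two sums forces equality termwise. *)
Lemma codeg_of_sum_sqr_eq : k = 1 -> \sum_v #|nbr e v| ^ 2 + #|T| = #|T| ^ 2 ->
  forall x y, x != y -> codeg e setT x y = ~~ e x y.
Proof.
move=> k1 eq_sum x y nxy.
have le_xy p : true -> ((p.1 != p.2) && ~~ e p.1 p.2 : nat)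
    <= (p.1 != p.2) * codeg e setT p.1 p.2
    ?= iff (((p.1 != p.2) && ~~ e p.1 p.2 : nat) == (p.1 != p.2) * codeg e setT p.1 p.2).
  move=> _; split=> //; have [//|npq] := eqVneq p.1 p.2; have [//|nepq] := boolP (e _ _).
  have [Q QP] := joinT (in_setT p.1) (in_setT p.2) npq nepq.
  by rewrite mul1n -[X in X <= _]k1 (common_clique_codeg QP).
have [_] := leqif_sum le_xy; rewrite -(pair_bigA _ (fun a b => (a != b) && ~~ e a b : nat)).
rewrite -(pair_bigA _ (fun a b => (a != b) * codeg e setT a b)) /=.
have -> : (\sum_x \sum_y ((x != y) && ~~ e x y) == \sum_x \sum_y (x != y) * codeg e setT x y).
  by apply/eqP; move: eq_sum; rewrite -sum_nonedges sum_sqr_nbr; lia.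
by move/esym/forallP/(_ (x, y))/eqP; rewrite /= nxy mul1n => <-.
Qed.

End DegreeSquares.

End CommonCliques.

(** * From saturation to common cliques, and from cores to isomorphisms *)

Lemma saturated_clique_joined (G : sgraph) r : 0 < r ->
  saturated (complete (r + 1)) G -> clique_joined (@edge G) setT (r - 1).
Proof.
move=> r_gt0 [noK satG] x y _ _ nxy nexy.
have [f [f_inj f_edge]] := satG x y nxy nexy.
(* The copy of the complete graph cannot lie in G, so some pair i, j is mapped to the new edge
   xy. *)
have [/forallP edge_f|] := boolP [forall i, forall j, (i != j) ==> edge (f i : G) (f j)].
  case: noK; exists f; split=> // i j nij.
  by move/forallP/(_ j)/implyP: (edge_f i); apply.
rewrite negb_forall => /existsP[i]; rewrite negb_forall => /existsP[j].
rewrite negb_imply => /andP[nij nfij].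
have fij : (f i == x) && (f j == y) || (f i == y) && (f j == x).
  by move: (f_edge i j nij); rewrite /= /add_rel (negPf nfij) => /andP[].
(* The other r - 1 vertices of the copy form the common clique. *)
pose Q := f @: (~: [set i; j]).
have notxy a : a \in Q -> (a != x) && (a != y).
  case/imsetP=> l; rewrite !inE negb_or => /andP[nli nlj] ->.
  have: (f l != f i) && (f l != f j) by rewrite !(inj_eq f_inj) nli.
  by case/orP: fij => /andP[/eqP-> /eqP->]; rewrite // andbC.
have edgeQ a l : a \in Q -> a != f l -> edge (a : G) (f l).
  move=> aQ; have /andP[/negPf nax /negPf nay] := notxy a aQ.
  case/imsetP: aQ nax nay => m _ -> nax nay; rewrite (inj_eq f_inj) => nml.
  by have := f_edge m l nml; rewrite /= /add_rel nax nay andbF orbF.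
exists Q; apply/common_cliqueP; split; first exact: subsetT.
- rewrite card_imset //; have := cardsC [set i; j].
  by rewrite cards2 nij card_ord; lia.
- by move=> a _ aQ /imsetP[l _ ->]; apply: edgeQ.
move=> a aQ; have /andP[nax nay] := notxy a aQ.
rewrite ![edge _ a]edge_sym; move: nax nay.
by case/orP: fij => /andP[/eqP<- /eqP<-] ai aj; rewrite !edgeQ.
Qed.

(** Vertices are numbered with S first, so that the labels below r - 1 are exactly those of S. *)
Lemma dominating_core_isomorphic (G : sgraph) n r (S : {set G}) : #|G| = n ->
  dominating_core (@edge G) setT (r - 1) S -> isomorphic G (split_graph n r).
Proof.
move=> cG [_ cS domS indS].
pose s := enum S ++ enum (~: S).
have mem_s x : x \in s by rewrite mem_cat !mem_enum inE orbN.
have size_s : size s = n by rewrite size_cat -!cardE cardsC.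
have idx_lt x : index x s < n by rewrite -size_s index_mem.
have idx_S x : (index x s < r - 1) = (x \in S).
  rewrite index_cat mem_enum -cS [#|S|]cardE; case: ifP => xS.
    by rewrite index_mem mem_enum.
  by apply/negbTE; rewrite -leqNgt leq_addr.
pose f x : split_graph n r := Ordinal (idx_lt x).
have f_inj : injective f.
  by move=> x y /(congr1 val) /= /(congr1 (nth x s)); rewrite !nth_index.
exists f; split; first by apply: inj_card_bij; rewrite // card_ord cG.
move=> x y; rewrite /= /split_rel (inj_eq f_inj) /= !idx_S.
have [->|nxy] /= := eqVneq x y; first by rewrite edge_irr.
have [xS|xS] := boolP (x \in S); first by rewrite domS.
have [yS|yS] := boolP (y \in S); first by rewrite edge_sym domS // eq_sym.
by apply/esym/negbTE/indS; rewrite !inE ?xS ?yS.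
Qed.

(** * Graphs with one common neighbour for nonadjacent vertices and none for adjacent ones *)

Section UniqueCommonNeighbour.

Variable G : sgraph.
Hypothesis codegE1 : forall x y : G, x != y -> codeg (@edge G) setT x y = ~~ edge x y.

Lemma triangle_free (x y z : G) : edge x y -> edge x z -> edge y z -> False.
Proof.
move=> exy exz eyz; have nxy : x != y by apply: contraTneq exy => ->; rewrite edge_irr.
move: (codegE1 nxy); rewrite codegE exy => /eqP; rewrite cards_eq0 => /eqP/setP/(_ z).
by rewrite !inE exz eyz.
Qed.

Lemma common_nbr (x y : G) : x != y -> ~~ edge x y -> exists2 z, edge x z & edge y z.
Proof.
move=> nxy nexy; move: (codegE1 nxy); rewrite codegE nexy /= => /eqP/cards1P[z /setP/(_ z)].
by rewrite !inE eqxx /= => /andP[exz eyz]; exists z.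
Qed.

Lemma common_nbr_unique (x y z t : G) : x != y ->
  edge x z -> edge y z -> edge x t -> edge y t -> z = t.
Proof.
move=> nxy exz eyz ext eyt; have : codeg (@edge G) setT x y <= 1.
  by rewrite codegE1 // leq_b1.
by rewrite codegE => /card_le1_eqP; apply; rewrite !inE ?exz ?ext.
Qed.

Lemma dominating_vertex_core (w : G) : (forall x, x != w -> edge w x) ->
  dominating_core (@edge G) setT 1 [set w].
Proof.
move=> domw; split; [exact: subsetT | exact: cards1 | | ].
  by move=> x y; rewrite inE => /eqP-> _; rewrite eq_sym; apply: domw.
move=> x y; rewrite !inE !andbT => nxw nyw; apply/negP=> exy.
exact: (triangle_free (domw x nxw) (domw y nyw)).
Qed.

(** A 3-cycle is a triangle, and in a 4-cycle opposite vertices have two common neighbours. *)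
Lemma cycle_ge5 (c : seq G) : graph_cycle c -> 5 <= size c.
Proof.
case: c => [|x [|y [|z [|t [|u c]]]]] [] //= _.
  case/andP=> /and4P[exy eyz ezx _] _.
  by case: (@triangle_free x y z); rewrite // edge_sym.
case/andP=> /and5P[exy eyz ezt etx _] /=; rewrite !inE !negb_or.
case/and3P=> /and3P[_ nxz _] /andP[_ nyt] _.
by move/eqP: nyt; case; apply: (common_nbr_unique nxz); rewrite // edge_sym.
Qed.

(** The cycle is v w p z q: p is the common neighbour of z and w, v is one of v1, v2 other than p,
    and q is the common neighbour of z and v. *)
Lemma cycle5_exists (w v1 v2 z : G) : edge w v1 -> edge w v2 -> v1 != v2 ->
  z != w -> ~~ edge z w -> exists2 c : seq G, graph_cycle c & size c = 5.
Proof.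
move=> ewv1 ewv2 nv12 nzw nezw; have [p ezp ewp] := common_nbr nzw nezw.
have [v ewv npv] : exists2 v, edge w v & p != v.
  have [pv1|] := eqVneq p v1; first by exists v2; rewrite // pv1.
  by exists v1.
have nzv : z != v by apply: contraNneq nezw => ->; rewrite edge_sym.
have nezv : ~~ edge z v.
  by apply: contra npv => ezv; rewrite (common_nbr_unique nzw ezp ewp ezv ewv).
have [q ezq evq] := common_nbr nzv nezv.
have npq : p != q.
  by apply/eqP=> pq; apply: (triangle_free ewv ewp); rewrite pq.
have neq (a b : G) : edge a b -> a != b by apply: contraTneq => ->; rewrite edge_irr.
have nwq : w != q by apply: contraNneq nezw => ->.
exists [:: v; w; p; z; q] => //; split=> //; apply/andP; split.
  by rewrite /= [edge v w]edge_sym ewv ewp [edge p z]edge_sym ezp ezq edge_sym evq.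
rewrite /= !inE !negb_or nwq npq (eq_sym v w) (neq _ _ ewv) (eq_sym v p) npv.
rewrite (eq_sym v z) nzv (neq _ _ evq) (neq _ _ ewp) (eq_sym w z) nzw.
by rewrite (eq_sym p z) (neq _ _ ezp) (neq _ _ ezq).
Qed.

Lemma diameter2_of_nonedge (x y : G) : x != y -> ~~ edge x y -> diameter G 2.
Proof.
have walk2 (a b : G) : a != b -> ~~ edge a b -> distance a b 2.
  move=> nab neab; have [c eac ebc] := common_nbr nab neab; split.
    by exists [:: c; b]; split; rewrite //= eac edge_sym ebc.
  move=> j [p [pathp lastp <-]]; case: p pathp lastp => [_ ab|d [|//]] /=.
    by rewrite -ab eqxx in nab.
  by rewrite andbT => ead db; rewrite -db ead in neab.
move=> nxy nexy; split; last by exists x, y; apply: walk2.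
move=> a b; have [->|nab] := eqVneq a b.
  by exists 0 => //; split=> //; exists [::].
have [eab|neab] := boolP (edge a b); last by exists 2 => //; apply: walk2.
exists 1 => //; split; first by exists [:: b]; split; rewrite //= eab.
by move=> j [[|c p] [_ ab <-]] //; rewrite -ab eqxx in nab.
Qed.

(** A dominating vertex is the centre of a star. Otherwise every vertex has a nonneighbour: a
    nonadjacent pair gives diameter 2, and its common neighbour w has two neighbours and a
    nonneighbour, which yields a 5-cycle. *)
Lemma star_or_moore : 0 < #|G| ->
  (exists S, dominating_core (@edge G) setT 1 S) \/ moore_diameter2 G.
Proof.
move=> G_gt0; have [/existsP[w /forallP domw]|] :=
  boolP [exists w : G, forall x, (x != w) ==> edge w x].
  left; exists [set w]; apply: dominating_vertex_core => x nxw.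
  by move/implyP: (domw x); apply.
rewrite negb_exists => /forallP nodom; right.
have nonnbr (w : G) : exists2 z, z != w & ~~ edge z w.
  move: (nodom w); rewrite negb_forall => /existsP[z].
  by rewrite negb_imply edge_sym => /andP[]; exists z.
have [x _] : exists x : G, true by case/card_gt0P: G_gt0 => x; exists x.
have [y nyx neyx] := nonnbr x; have [w eyw exw] := common_nbr nyx neyx.
have [z nzw nezw] := nonnbr w.
split; first exact: diameter2_of_nonedge nyx neyx.
split; last exact: cycle_ge5.
by apply: (cycle5_exists (w := w) (v1 := y) (v2 := x) (z := z)); rewrite // edge_sym.
Qed.

End UniqueCommonNeighbour.

(** * The degree-square bound and its extremal graphs *)

Theorem theorem1p1 (r n : nat) (G : sgraph)
    (hr : 2 <= r) (hn : r + 1 <= n) (hG : #|G| = n)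
    (hsat : saturated (complete (r + 1)) G) :
  let bound := (n - 1) ^ 2 * (r - 1) + (r - 1) ^ 2 * (n - r + 1) in
  [/\ bound <= \sum_(v : G) deg v ^ 2,
      r = 2 -> \sum_(v : G) deg v ^ 2 = bound ->
        isomorphic G (split_graph n 2) \/ moore_diameter2 G
    & 3 <= r -> \sum_(v : G) deg v ^ 2 = bound ->
        isomorphic G (split_graph n r)].
Proof.
move=> bound; have r_gt0 : 0 < r by lia.
have s_gt0 : 0 < r - 1 by lia.
have joinG := saturated_clique_joined r_gt0 hsat.
have sqr_bound := sum_sqr_nbr_lower_bound (@edge_sym G) (@edge_irr G) joinG s_gt0.
have edge_bound := arcs_lower_bound (@edge_sym G) (@edge_irr G) joinG.
rewrite -[\sum_(v : G) _]/(\sum_(v : G) #|nbr (@edge G) v| ^ 2).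
have rE : (r - 1).+1 = r by lia.
rewrite arcsT cardsT hG rE in edge_bound; rewrite hG -subn1 in sqr_bound.
(* Inserting the edge bound into [sqr_bound] gives exactly [bound]; negative terms are moved
   across. *)
have boundE : bound + (r - 1) ^ 2 * n + (r - 1 - 1) * ((r - 1) * r) =
    (r - 1) * n ^ 2 + (r - 1 - 1) * (2 * (r - 1) * n).
  (* Writing n = r + 1 + m and r = 2 + t removes the truncated subtractions. *)
  rewrite /bound; have -> : n = r + 1 + (n - (r + 1)) by lia.
  move: (n - (r + 1)) => m; have -> : r = 2 + (r - 2) by lia.
  move: (r - 2) => t.
  have -> : 2 + t - 1 = t.+1 by lia.
  have -> : 2 + t + 1 + m - 1 = t + m + 2 by lia.
  have -> : 2 + t + 1 + m - (2 + t) + 1 = m + 2 by lia.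
  by rewrite -!mulnn; lia.
have edge_bound' := leq_mul (leqnn (r - 1 - 1)) edge_bound.
rewrite mulnDr in edge_bound'.
split; first by lia.
- move=> r2 eq_bound; subst r.
  (* For r = 2 the bound is (n - 1)^2 + (n - 1) = n^2 - n. *)
  have eq_sum : \sum_v #|nbr (@edge G) v| ^ 2 + #|G| = #|G| ^ 2.
    by rewrite eq_bound hG /bound; case: (n) hn => // m m_gt1; rewrite -!mulnn; nia.
  have codegE1 := codeg_of_sum_sqr_eq (@edge_sym G) (@edge_irr G) joinG (erefl _) eq_sum.
  have G_gt0 : 0 < #|G| by lia.
  have [[S coreS]|] := star_or_moore codegE1 G_gt0; last by right.
  by left; apply: (dominating_core_isomorphic (r := 2) hG coreS).
move=> r3 eq_bound.
(* Equality makes r - 2 times the edge bound tight, and r - 2 > 0 can be cancelled. *)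
have edge_eq : \sum_v #|nbr (@edge G) v| + (r - 1) * r = 2 * (r - 1) * n.
  apply/eqP; rewrite eqn_leq edge_bound andbT -(leq_pmul2l (m := r - 1 - 1)); last by lia.
  by rewrite mulnDr; lia.
have [||S coreS] := arcs_eq_core (@edge_sym G) (@edge_irr G) joinG.
- by rewrite cardsT hG; lia.
- by rewrite arcsT cardsT hG rE.
exact: dominating_core_isomorphic hG coreS.
Qed.
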